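(* Let $(Y,\mathscr{A},\mu)$ be a probability space, $T:Y\to Y$ a measurable map preserving $\mu$, $r\in L^1(Y,\mu)$ a real-valued function with $\inf r>0$, $\overline r=\int_Y r\,d\mu$, and $D\in\mathscr{A}$. Let $\varphi^t:X\to X$ ($t\ge 0$) be the suspension semi-flow of $T$ with roof function $r$, let $\nu$ be its invariant probability measure on $X$, and for $x\in X$ let $P(x)=\sum_{t\in H(x,D)}\delta_t$ with $H(x,D)=\{t>0 \mid \varphi^t x\in D\times\{0\}\}$. Then the simple point process $\xi=P(x)$ on $\mathbb{R}_{>0}$, with $x\in X$ distributed according to $\nu$, is stationary on $\mathbb{R}_{>0}$ with intensity $I_\xi=\overline r^{-1}\mu(D)$.
   Context: Suspension semi-flow: $X=\{(y,s)\mid y\in Y,\ 0\le s<r(y)\}$ (with the $\sigma$-algebra induced from the product $\sigma$-algebra on $Y\times\mathbb{R}_{\ge 0}$), $S_0(y)=0$, $S_n(y)=\sum_{j=0}^{n-1}r(T^jy)$ for $n\ge1$, and for $t\ge0$ $$\varphi^t(y,s)=(T^ny,\ s+t-S_n(y))\quad\text{if } S_n(y)\le s+t<S_{n+1}(y),\ n=0,1,2,\ldots.$$ The $\varphi^t$-invariant probability measure $\nu$ on $X$ is given by $\int_X f(x)\,\nu(dx)=\frac1{\overline r}\int_Y\big(\int_0^{r(y)}f((y,s))\,ds\big)\mu(dy)$ for every measurable $f:X\to\mathbb{R}_{\ge0}$. Point processes: $\mathcal{M}(\mathbb{R}_{>0})$ is the space of locally finite Borel measures on $\mathbb{R}_{>0}$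 with the vague topology, and $\mathcal{N}(\mathbb{R}_{>0})$ is its subset of integer-valued measures (values in $\mathbb{Z}\cup\{\infty\}$ on Borel sets). A point process on $\mathbb{R}_{>0}$ is a random measure in $\mathcal{N}(\mathbb{R}_{>0})$; it is called simple if $\sup_t\zeta\{t\}\le1$ almost surely. Stationarity: for $u\ge0$ the shift is $\theta^u\zeta B=\zeta(B+u)$ for Borel sets $B\subset\mathbb{R}_{>0}$. A random measure $\zeta$ in $\mathcal{M}(\mathbb{R}_{>0})$ is stationary if $\theta^u\zeta$ has the same distribution as $\zeta$ for all $u\ge0$. The intensity of a stationary random measure $\zeta$ is $I_\zeta=\mathbb{E}\,\zeta(0,R]/R$, which is independent of the choice of $R>0$. *)

(* Defs.v *)
From HB Require Import structures.
From mathcomp Require Import all_boot all_order all_algebra.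
From mathcomp Require Import all_classical all_reals all_analysis.
Set Implicit Arguments.
Unset Strict Implicit.
Unset Printing Implicit Defensive.
Import Order.TTheory GRing.Theory Num.Theory.
Import numFieldNormedType.Exports.
Local Open Scope classical_set_scope.
Local Open Scope ring_scope.

Notation borel T := (g_sigma_algebraType (@open T)).

Section positive_reals.
Variable R : realType.

Definition Rpos : Type := set_type [set t : R | 0 < t].

HB.instance Definition _ := Topological.on Rpos.

Lemma Rpos_gt0 (t : Rpos) : 0 < \val t.
Proof. exact: (set_valP t). Qed.

Definition mkRpos (t : R) (t0 : 0 < t) : Rpos := exist _ t (mem_set t0).

HB.instance Definition _ := isPointed.Build Rpos (mkRpos ltr01).

Definition translate (u : {nonneg R}) (B : set Rpos) : set Rpos :=
  [set t | exists2 s, B s & \val t = \val s + u%:num].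

Definition locally_finite (m : {measure set (borel Rpos) -> \bar R}) : Prop :=
  forall t : Rpos, exists U : set Rpos, [/\ open U, U t & (m U < +oo)%E].

(* A library measure is a function on all sets, so two elements of [lfmeasure]
   may agree on every Borel set and still differ; the vague topology, hence its
   Borel sigma-algebra, does not separate them. *)
Record lfmeasure := LFMeasure {
  lfm :> {measure set (borel Rpos) -> \bar R} ;
  lfmP : locally_finite lfm }.

HB.instance Definition _ := gen_eqMixin lfmeasure.
HB.instance Definition _ := gen_choiceMixin lfmeasure.

Lemma locally_finite_mzero : locally_finite mzero.
Proof.
by move=> t; exists setT; split => //; [exact: openT|rewrite /mzero ltry].
Qed.

HB.instance Definition _ :=
  isPointed.Build lfmeasure (LFMeasure locally_finite_mzero).

Definition Cc : set (Rpos -> R) :=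
  [set f | continuous f /\ compact (closure [set t | f t != 0])].

(* The vague topology: the coarsest one for which every map
   zeta |-> \int[zeta]_t f t with f in Cc is continuous. *)
HB.instance Definition _ := @isSubBaseTopological.Build lfmeasure
  ((Rpos -> R) * set R)%type
  [set fU | Cc fU.1 /\ open fU.2]
  (fun fU => [set zeta : lfmeasure | fU.2 (\int[zeta]_t fU.1 t)]).

Definition integer_valued : set lfmeasure :=
  [set zeta | forall B : set (borel Rpos), measurable B ->
    zeta B = +oo%E \/ exists k : int, zeta B = (k%:~R)%:E].

End positive_reals.

Section shift.
Variable R : realType.
Implicit Types (u : {nonneg R}) (B U : set (Rpos R)).

Definition Rpos_add (s : Rpos R) u : Rpos R :=
  mkRpos (ltr_wpDr (ge0 u) (Rpos_gt0 s)).

Lemma translateE u B : translate u B = (Rpos_add ^~ u) @` B.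
Proof.
apply/seteqP; split=> t [s Bs].
  by move=> ts; exists s => //; apply/val_inj; rewrite ts.
by move=> <-; exists s.
Qed.

Lemma translate_bigcup u (F : nat -> set (Rpos R)) :
  translate u (\bigcup_i F i) = \bigcup_i translate u (F i).
Proof. by rewrite translateE image_bigcup; under [RHS]eq_bigcupr do rewrite translateE. Qed.

Lemma translate_preimage u B : (Rpos_add ^~ u) @^-1` translate u B = B.
Proof.
rewrite translateE; apply/seteqP; split => [s [t Bt]|s Bs]; last by exists s.
by move=> /(congr1 val)/= /addIr/val_inj <-.
Qed.

Lemma open_Rpos (U : set (Rpos R)) :
  open U <-> exists2 V : set R, open V & \val @^-1` V = U.
Proof. by split=> -[V oV VU]; exists V. Qed.

Lemma open_translate u U : open U -> open (translate u U).
Proof.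
move=> /open_Rpos[V oV VU]; apply/open_Rpos.
exists ((fun t => t - u%:num) @^-1` (V `&` `]0, +oo[)).
  apply: open_comp; last exact: openI.
  by move=> x _; apply: cvgB; [exact: cvg_id|exact: cvg_cst].
apply/seteqP; split => t /=.
  rewrite in_itv/= andbT => -[Vt t0]; exists (mkRpos t0); last by rewrite /= subrK.
  by rewrite -VU.
move=> [s Us ->]; rewrite addrK in_itv/= andbT; split; last exact: Rpos_gt0.
by move: Us; rewrite -VU.
Qed.

Lemma open_Rpos_add u U : open U -> open ((Rpos_add ^~ u) @^-1` U).
Proof.
move=> /open_Rpos[V oV <-]; apply/open_Rpos.
exists ((fun t => t + u%:num) @^-1` V) => //.
apply: open_comp => // x _; apply: cvgD; [exact: cvg_id|exact: cvg_cst].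
Qed.

Lemma measurable_translate u (B : set (borel (Rpos R))) :
  measurable B -> measurable (translate u B : set (borel (Rpos R))).
Proof.
pose M := [set B : set (borel (Rpos R)) |
  measurable (translate u B : set (borel (Rpos R)))].
suff: <<s @open (Rpos R) >> `<=` M by apply.
have Mopen U : open U -> M U.
  by move=> oU; apply: sub_sigma_algebra; exact: open_translate.
apply: smallest_sub; last exact: Mopen.
split.
- by apply: Mopen; exact: open0.
- move=> A MA; rewrite /M/= (_ : translate u _ = translate u setT `\` translate u A).
    by apply: measurableD => //; apply: Mopen; exact: openT.
  apply/seteqP; split=> t /=.
    move=> [s [_ As] ts]; split; first by exists s.
    by move=> [s' As']; rewrite ts => /addIr/val_inj ss'; apply: As; rewrite ss'.
  move=> [[s _ ts] At]; exists s => //; split=> // As.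
  by apply: At; exists s.
- move=> F MF; rewrite /M/= translate_bigcup.
  by apply: bigcupT_measurable => i; exact: MF.
Qed.

Section shifted_measure.
Variables (u : {nonneg R}) (zeta : {measure set (borel (Rpos R)) -> \bar R}).

Definition shift_measure (B : set (borel (Rpos R))) : \bar R :=
  zeta (translate u B).

Let shift0 : shift_measure set0 = 0%E.
Proof.
rewrite /shift_measure (_ : translate u _ = set0) ?measure0//.
by rewrite translateE image_set0.
Qed.

Let shift_ge0 B : (0 <= shift_measure B)%E.
Proof. exact: measure_ge0. Qed.

Let shift_sigma_additive : semi_sigma_additive shift_measure.
Proof.
move=> F mF tF mUF; rewrite /shift_measure translate_bigcup.
apply: measure_semi_sigma_additive.
- by move=> i; exact: measurable_translate.
- apply/trivIsetP => i j _ _ ij; rewrite !translateE.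
  apply/seteqP; split=> // t [[s Fs <-] [s' Fs' /(congr1 val)/= /addIr/val_inj ss']].
  move/trivIsetP : tF => /(_ i j Logic.I Logic.I ij) FiFj.
  have : (F i `&` F j) s by split => //; rewrite -ss'.
  by rewrite FiFj.
- by rewrite -translate_bigcup; exact: measurable_translate.
Qed.

HB.instance Definition _ := isMeasure.Build _ _ _ shift_measure
  shift0 shift_ge0 shift_sigma_additive.

End shifted_measure.

Lemma locally_finite_shift u (zeta : lfmeasure R) :
  locally_finite (shift_measure u zeta).
Proof.
move=> t; have [U [oU Ut Uoo]] := lfmP zeta (Rpos_add t u).
exists ((Rpos_add ^~ u) @^-1` U); split => //; first exact: open_Rpos_add.
have oV : open ((Rpos_add ^~ u) @^-1` U) by exact: open_Rpos_add.
apply: le_lt_trans Uoo; apply: le_measure; rewrite ?inE.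
- by apply: measurable_translate; exact: sub_sigma_algebra.
- exact: sub_sigma_algebra.
- by rewrite translateE => _ [s Us <-].
Qed.

Definition shift u (zeta : lfmeasure R) : lfmeasure R :=
  LFMeasure (@locally_finite_shift u zeta).

End shift.

Section point_processes.
Context (d : measure_display) (Omega : measurableType d) (R : realType).
Variables (P : probability Omega R) (xi : Omega -> lfmeasure R).

Definition random_measure : Prop :=
  measurable_fun setT (xi : Omega -> borel (lfmeasure R)).

Definition point_process : Prop :=
  random_measure /\ forall w, integer_valued (xi w).

Definition simple : Prop :=
  {ae P, forall w, (ereal_sup [set xi w [set t] | t in setT] <= 1)%E}.

Definition stationary : Prop :=
  forall (u : {nonneg R}) (A : set (borel (lfmeasure R))), measurable A ->
    pushforward P (fun w => shift u (xi w) : borel (lfmeasure R)) A =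
    pushforward P (xi : Omega -> borel (lfmeasure R)) A.

Definition intensity (L : R) : \bar R :=
  ((\int[P]_w xi w [set t : Rpos R | (\val t <= L)%R]) * (L^-1)%:E)%E.

End point_processes.

Section suspension.
Context (d : measure_display) (Y : measurableType d) (R : realType).
Variables (T : Y -> Y) (r : Y -> R).

Lemma roof_ge (r_gt0 : 0 < inf (range r)) y : inf (range r) <= r y.
Proof.
apply: ge_inf; last by exists y.
apply: contrapT => nlb; move: r_gt0.
by rewrite inf_out ?ltxx// => -[_ /nlb].
Qed.

(* The proof that the roof function is bounded below is an argument of the
   type because measurable types are pointed, hence inhabited. *)
Definition susp (r_gt0 : 0 < inf (range r)) : Type :=
  {x : Y * R | (0 <= x.2) && (x.2 < r x.1)}.

Hypothesis r_gt0 : 0 < inf (range r).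

Local Notation X := (susp r_gt0).

HB.instance Definition _ := SubType.on X.
HB.instance Definition _ := Choice.on X.

Let base (y : Y) : Y * R := (y, 0).

Lemma base_in_susp y : (0 <= (base y).2) && ((base y).2 < r (base y).1).
Proof. by rewrite lexx/= (lt_le_trans r_gt0)// roof_ge. Qed.

HB.instance Definition _ :=
  isPointed.Build X (exist _ (base point) (base_in_susp point)).

HB.instance Definition _ := Measurable.copy X
  (g_sigma_algebra_preimageType (\val : X -> Y * R)).

Definition birkhoff (n : nat) (y : Y) : R := \sum_(j < n) r (iter j T y).

Definition flow_index (y : Y) (a : R) : nat :=
  xget 0%N [set n | birkhoff n y <= a < birkhoff n.+1 y].

(* For [t < 0] the value is irrelevant; for [0 <= t] the default value [x] of
   [insubd] is never used, see [semiflowE] below. *)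
Definition semiflow (t : R) (x : X) : X :=
  let: (y, s) := \val x in
  let n := flow_index y (s + t) in
  insubd x (iter n T y, s + t - birkhoff n y).

Lemma birkhoffS n y : birkhoff n.+1 y = birkhoff n y + r (iter n T y).
Proof. by rewrite /birkhoff big_ord_recr. Qed.

Lemma birkhoff_ge n y : n%:R * inf (range r) <= birkhoff n y.
Proof.
elim: n => [|n IH]; first by rewrite /birkhoff big_ord0 mul0r.
by rewrite birkhoffS -natr1 mulrDl mul1r lerD// roof_ge.
Qed.

Lemma le_birkhoff m n y : (m <= n)%N -> birkhoff m y <= birkhoff n y.
Proof.
elim: n => [|n IH]; first by rewrite leqn0 => /eqP ->.
rewrite leq_eqVlt => /predU1P[->//|/IH /le_trans]; apply.
by rewrite birkhoffS lerDl (le_trans (ltW r_gt0))// roof_ge.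
Qed.

Lemma flow_index_exists y a : 0 <= a ->
  exists n, birkhoff n y <= a < birkhoff n.+1 y.
Proof.
move=> a0.
have [n an] : exists n, a < birkhoff n y.
  exists (Num.truncn (a / inf (range r))).+1.
  apply: lt_le_trans (birkhoff_ge _ _); rewrite -ltr_pdivrMr//.
  exact: truncnS_gt.
elim: n an => [|n IH an]; first by rewrite /birkhoff big_ord0 ltNge a0.
by have [/IH//|na] := ltP a (birkhoff n y); exists n; rewrite na.
Qed.

Lemma flow_index_unique y a m n : birkhoff m y <= a < birkhoff m.+1 y ->
  birkhoff n y <= a < birkhoff n.+1 y -> m = n.
Proof.
move=> /andP[ma am] /andP[na an]; apply/eqP; rewrite eqn_leq.
apply/andP; split; rewrite leqNgt; apply/negP => /(@le_birkhoff _ _ y) le.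
- by have := lt_le_trans an (le_trans le ma); rewrite ltxx.
- by have := lt_le_trans am (le_trans le na); rewrite ltxx.
Qed.

Lemma semiflowE (t : R) (x : X) (n : nat) : 0 <= t ->
  birkhoff n (\val x).1 <= (\val x).2 + t < birkhoff n.+1 (\val x).1 ->
  \val (semiflow t x) =
    (iter n T (\val x).1, (\val x).2 + t - birkhoff n (\val x).1).
Proof.
rewrite /semiflow; case: x => -[y s] ys /= t0 nst.
have -> : flow_index y (s + t) = n.
  rewrite /flow_index; case: xgetP => [m _ mst|/(_ n)]; last by rewrite /= nst.
  exact: flow_index_unique mst nst.
rewrite insubdK//; move: nst => /andP[nst stn].
by rewrite unfold_in/= subr_ge0 nst/= ltrBlDl -birkhoffS.
Qed.

(* [\int[mu]_y (\int_(0 <= s < r y) f (y, s))], with [f : X -> R] extended by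
   [0] to [Y * R]; the extension is only evaluated at points of [X]. *)
Definition susp_ext (f : X -> R) (p : Y * R) : R := oapp f 0 (insub p).

Definition susp_measure (mu : probability Y R) (nu : probability X R) : Prop :=
  forall f : X -> R, measurable_fun setT f -> (forall x, 0 <= f x) ->
    (\int[nu]_x (f x)%:E =
     ((\int[mu]_y r y)%R^-1)%:E *
       \int[mu]_y \int[lebesgue_measure]_(s in `[0%R, r y[)
         (susp_ext f (y, s))%:E)%E.

Definition hits (D : set Y) (x : X) : set (Rpos R) :=
  [set t | (D `*` [set 0]) (\val (semiflow (\val t) x))].

End suspension.

Section dirac_sums.
Context (d : measure_display) (S : measurableType d) (R : realType).
Variable H : set S.

Definition dirac_sum (A : set S) : \bar R := (\esum_(t in H) \d_t A)%E.

Let dirac_sum0 : dirac_sum set0 = 0%E.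
Proof. by apply: esum1 => t _; exact: measure0. Qed.

Let dirac_sum_ge0 A : (0 <= dirac_sum A)%E.
Proof. by apply: esum_ge0 => t _; exact: measure_ge0. Qed.

Let dirac_sum_sigma_additive : semi_sigma_additive dirac_sum.
Proof.
move=> F mF tF mUF.
have dF0 (t : S) i : (0 <= (\d_t (F i) : \bar R))%E by exact: measure_ge0.
rewrite [X in _ --> X](_ : _ = (\sum_(i <oo) dirac_sum (F i))%E).
  by apply: is_cvg_nneseries => i _ _; exact: dirac_sum_ge0.
rewrite nneseries_esumT; last by move=> i; exact: dirac_sum_ge0.
rewrite /dirac_sum [RHS]esum_esum; last by move=> i t _ _; exact: dF0.
transitivity (\esum_(t in H) \esum_(i in [set: nat]) (\d_t (F i) : \bar R))%E.
  apply: eq_esum => t Ht; rewrite -nneseries_esumT//.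
  by apply/esym/cvg_lim => //; exact: measure_semi_sigma_additive.
rewrite esum_esum; last by move=> t i _ _; exact: dF0.
rewrite (reindex_esum (setT `*`` (fun=> H)) _ (fun k => (k.2, k.1)))//.
split.
- by move=> [i t] [].
- by move=> [i t] [j u] _ _ [-> ->].
- by move=> [t i] [Ht _]; exists (i, t).
Qed.

HB.instance Definition _ := isMeasure.Build _ _ _ dirac_sum
  dirac_sum0 dirac_sum_ge0 dirac_sum_sigma_additive.

End dirac_sums.

Section hitting_process.
Context (d : measure_display) (Y : measurableType d) (R : realType).
Variables (T : Y -> Y) (r : Y -> R) (r_gt0 : 0 < inf (range r)) (D : set Y).

Lemma hits_finite (x : susp r_gt0) (b : R) :
  finite_set (hits T D x `&` [set t | \val t < b]).
Proof.
pose y := (\val x).1; pose s := (\val x).2.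
pose N := (Num.truncn ((s + b) / inf (range r))).+1.
have finN : finite_set ((fun n => birkhoff T r n y - s) @` `I_N).
  exact/finite_image/finite_II.
apply: sub_finite_set (finite_preimage (f := \val) _ finN); last first.
  by move=> ? ? _ _ /val_inj.
move=> t [[_ ht0] tb].
have t0 : 0 < \val t by exact: Rpos_gt0.
have s0 : 0 <= s by have /andP[] := valP x.
have [n nst] := @flow_index_exists _ _ _ T r r_gt0 y (s + \val t)
  (addr_ge0 s0 (ltW t0)).
have := semiflowE (ltW t0) nst => E.
move: ht0; rewrite E/= => /eqP; rewrite subr_eq0 => /eqP st.
exists n; last by rewrite -st addrAC subrr add0r.
have := birkhoff_ge T r_gt0 n y; rewrite -st => le_n.
suff : n%:R < N%:R :> R by rewrite ltr_nat.
apply: le_lt_trans (truncnS_gt _); rewrite ler_pdivlMr//.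
by rewrite (le_trans le_n)// lerD2l ltW.
Qed.

Lemma locally_finite_hits (x : susp r_gt0) :
  locally_finite (dirac_sum R (hits T D x : set (borel (Rpos R)))).
Proof.
move=> t; pose U : set (Rpos R) := [set v | \val v < \val t + 1].
exists U; split.
- apply/open_Rpos; exists [set v | v < \val t + 1] => //.
- by rewrite /U/= ltrDl.
have fin : (\esum_(i in hits T D x `&` U) (1 : \bar R) < +oo)%E.
  rewrite esum_fset//; last exact: hits_finite.
  rewrite fsbig_finite/=; last exact: hits_finite.
  by apply/lte_sum_pinfty => i _; rewrite ltry.
apply: le_lt_trans fin; rewrite esum_mkcondr; apply: le_esum => v _.
by rewrite diracE; case: ifP.
Qed.

Definition hitting_measure (x : susp r_gt0) : lfmeasure R :=
  LFMeasure (locally_finite_hits x).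

End hitting_process.

(* Main.v *)
Require Import Defs.
From HB Require Import structures.
From mathcomp Require Import all_boot all_order all_algebra.
From mathcomp Require Import all_classical all_reals all_analysis.
From mathcomp Require Import finmap lra measurable_realfun.
Set Implicit Arguments.
Unset Strict Implicit.
Unset Printing Implicit Defensive.
Import Order.TTheory GRing.Theory Num.Theory.
Import numFieldNormedType.Exports.
Local Open Scope classical_set_scope.
Local Open Scope ring_scope.

(** Write a point of the suspension as x = (y, s) and let S_n be the Birkhoff
    sums of the roof function.  The forward orbit of x meets the base Y * {0}
    exactly at the times S_n(y) - s that are positive, and then at the point
    T^n y; hence the hitting process of D is the locally finite sum, over those
    n with T^n y in D and S_n(y) > s, of the Dirac masses at S_n(y) - s
    ([hitsP]).  Everything is read off this formula.

    Measurability.  The Borel sigma-algebra of the vague topology is generated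
    by uncountably many integral functionals, so testing them one by one only
    handles the subbase and not arbitrary unions.  Instead, x is described by
    countably many real coordinates, the times S_n(y) - s and the marks
    1_D(T^n y).  They depend measurably on x, and the hitting measure depends
    continuously on them ([cvg_hitting_measure]): against a test function
    supported below b only finitely many atoms count, uniformly near x.  A set
    that contains a rational box in the coordinates around each of its points
    is a countable union of such boxes, hence measurable
    ([measurable_box_open]).

    Stationarity.  Shifting the hitting measure of x by u gives the hitting
    measure of the flowed point ([shift_hitting_measure]), so it suffices that
    the semi-flow preserves nu ([semiflow_invariant]).  Unfold a subset of the
    suspension along the orbits into a set G of Y * [0, +oo[, for which
    (y, s + r y) is in G if and only if (T y, s) is.  Cutting the section of G
    over [0, u + r y[ either at u or at r y gives
      |G_y /\ [0, u[| + |G_y /\ [u, u + r y[|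
        = |G_y /\ [0, r y[| + |G_(T y) /\ [0, u[|.
    After integration over y the terms with [0, u[ are equal, since T preserves
    mu, and finite, so that they cancel; the two others are, up to the factor
    1 / rbar, the measures of the preimage under the semi-flow and of the set.

    Intensity.  The points x whose n-th visit occurs in ]0, L] with a mark form
    a set whose fibre over y, for n >= 1, has length
      1_D(T^n y) * (min(S_n y, L) - min(S_(n-1) (T y), L)).
    By invariance of mu the integrals of these lengths telescope
    ([sum_visit_windows]), and as soon as S_n >= L the last term of the
    telescope is L * mu D ([integral_capped_birkhoff]). *)

(** * Rational boxes in countably many real coordinates *)
Section rational_boxes.
Context d (X : measurableType d) (R : realType) (I : countType).
Variable g : I -> X -> R.

Definition box (w : seq (I * (rat * rat))) : set X :=
  [set x | forall i, i \in w -> ratr i.2.1 < g i.1 x < ratr i.2.2].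

(** The neighborhoods of [x] in the initial topology of the family [g]. *)
Definition box_filter (x : X) : set_system X :=
  filter_from [set w | box w x] box.

Global Instance box_filter_filter x : Filter (box_filter x).
Proof.
apply: filter_from_filter; first by exists [::].
move=> u v ux vx; exists (u ++ v) => [i|y uvy]; rewrite ?mem_cat.
- by move=> /orP[/ux|/vx].
- by split=> i iw; apply: uvy; rewrite mem_cat iw ?orbT.
Qed.

Lemma cvg_box_filter i x : g i @ box_filter x --> g i x.
Proof.
apply/cvgrPdist_lt => e e0.
have [p /itvP pg] : exists p : rat, ratr p \in `]g i x - e, g i x[.
  by apply: rat_in_itvoo; rewrite ltrBlDr ltrDl.
have [q /itvP qg] : exists q : rat, ratr q \in `]g i x, g i x + e[.
  by apply: rat_in_itvoo; rewrite ltrDl.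
exists [:: (i, (p, q))] => [_ /[!inE]/eqP ->/=|y /(_ (i, (p, q)))].
  by rewrite pg qg.
rewrite inE => /(_ (eqxx _))/andP[/= py yq].
rewrite ltr_distlC (lt_trans _ py) ?pg//= (lt_trans yq) ?qg//.
Qed.

Hypothesis mg : forall i, measurable_fun setT (g i).

Lemma measurable_box w : measurable (box w).
Proof.
elim: w => [|i w IH].
  by rewrite (_ : box _ = setT)//; apply/seteqP; split.
rewrite (_ : box _ = g i.1 @^-1` `]ratr i.2.1, ratr i.2.2[ `&` box w).
  by apply: measurableI => //; rewrite -[_ @^-1` _]setTI; exact: mg.
apply/seteqP; split => x /=.
  move=> iwx; rewrite in_itv/= iwx ?mem_head//; split=> // j jw.
  by apply: iwx; rewrite inE jw orbT.
by rewrite in_itv/= => -[ix wx] j /[!inE]/predU1P[->//|/wx].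
Qed.

(** The initial topology of countably many measurable real functions is second
    countable with a measurable base, so all its open sets are measurable. *)
Lemma measurable_box_open (A : set X) :
  (forall x, A x -> box_filter x A) -> measurable A.
Proof.
move=> Ao.
rewrite (_ : A = \bigcup_w if `[< box w `<=` A >] then box w else set0).
  apply: countable_bigcupT_measurable => // w.
  by case: ifP => _; [exact: measurable_box|exact: measurable0].
apply/seteqP; split => [x Ax|x [w _]]; last by case: asboolP => // /[apply].
have [w wx wA] := Ao _ Ax.
by exists w => //; rewrite asboolT.
Qed.

End rational_boxes.

(** * Test functions and the vague topology *)
Section vague_topology.
Context (R : realType).
Implicit Types (f : Rpos R -> R) (zeta : lfmeasure R).

(** A vague neighborhood is cut out by finitely many conditions on integrals of
    test functions, hence belongs to any filter along which all of these
    integrals converge. *)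
Lemma vague_cvg (X : Type) (F : set_system X) (xi : X -> lfmeasure R) zeta :
  Filter F ->
  (forall f, Cc f ->
    (\int[xi x]_t f t)%R @[x --> F] --> (\int[zeta]_t f t)%R) ->
  xi @ F --> zeta.
Proof.
move=> FF cvgf; rewrite /cvg_to/= => U.
rewrite nbhsE => -[B [[E EI <-] [V EV Vzeta] BU]].
have /= [s sD VE] := EI _ EV.
rewrite /nbhs/=; apply: (filterS (P := xi @^-1` V)).
  by move=> x /= Vx; apply: BU; exists V.
rewrite -VE -(set_fsetK s)/=.
have : F (\bigcap_(i in [set` s]) [set x | i.2 (\int[xi x]_t i.1 t)%R]).
  apply: filter_bigI => i is_.
  have /set_mem[Cf oi] := sD _ is_.
  apply: (cvgf _ Cf); apply: open_nbhs_nbhs; split => //.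
  by move: Vzeta; rewrite -VE => /(_ _ is_).
by rewrite set_fsetK; apply: filterS => x /= H i is_; exact: H.
Qed.

Lemma continuous_measurable_Rpos f : continuous f ->
  measurable_fun setT (f : borel (Rpos R) -> R).
Proof.
move=> /continuousP fc.
apply: (measurability _ (measurable_realfun.RGenOpens.measurableE R)) => _ [_ [a [b ->] <-]].
by rewrite setTI; apply: sub_sigma_algebra; apply: fc; exact: interval_open.
Qed.

(** The value 1 at nonpositive arguments is arbitrary. *)
Definition to_Rpos (a : R) : Rpos R :=
  if pselect (0 < a) is left a0 then mkRpos a0 else mkRpos ltr01.

Lemma to_RposK a : 0 < a -> \val (to_Rpos a) = a.
Proof. by rewrite /to_Rpos; case: pselect. Qed.

Definition ext0 f (a : R) : R := if 0 < a then f (to_Rpos a) else 0.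

Lemma ext0_val f t : ext0 f (\val t) = f t.
Proof.
rewrite /ext0 Rpos_gt0; congr f.
by apply/val_inj; rewrite to_RposK// Rpos_gt0.
Qed.

Lemma ext0_le0 f a : a <= 0 -> ext0 f a = 0.
Proof. by rewrite /ext0 leNgt => /negbTE ->. Qed.

Lemma continuous_val_Rpos : continuous (\val : Rpos R -> R).
Proof.
apply/continuousP => A oA; apply/open_Rpos; by exists A.
Qed.

(** The support is compact in the positive half-line, so its image in the real
    line is compact and misses 0: it stays away from 0 and from infinity. *)
Lemma Cc_support f : Cc f ->
  exists a b, 0 < a /\ forall t, f t != 0 -> a < \val t < b.
Proof.
move=> [_]; set K := closure _ => cK.
have cvK : compact (\val @` K).
  apply: continuous_compact => //; apply: continuous_subspaceT.
  exact: continuous_val_Rpos.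
have [M _ KM] := pinfty_ex_gt0 (compact_bounded cvK).
have : nbhs (0:R) (~` (\val @` K)).
  apply: open_nbhs_nbhs; split.
    by apply: closed_openC; apply: compact_closed => //; exact: Rhausdorff.
  by move=> [t _ t0]; have := Rpos_gt0 t; rewrite t0 ltxx.
move=> /nbhs_ballP[/= e e0 eK].
exists (e / 2), (M + 1); split => [|t ft]; first by rewrite divr_gt0.
have Kt : K t by exact: subset_closure.
apply/andP; split; last first.
  rewrite ltr_pwDr//; apply: le_trans (KM (\val t) _); last by exists t.
  exact: ler_norm.
rewrite ltNge; apply/negP => te.
have t0 := Rpos_gt0 t.
apply: (eK (\val t)); last by exists t.
rewrite /ball/= sub0r normrN gtr0_norm//.
by apply: le_lt_trans te _; rewrite ltr_pdivrMr// ltr_pMr// ltr1n.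
Qed.

(** Continuity at 0 uses that a test function vanishes near 0.  This is what
    keeps integrals continuous when an atom leaves the half-line through 0. *)
Lemma continuous_ext0 f : Cc f -> continuous (ext0 f).
Proof.
move=> Cf a; have [c [b [c0 fcb]]] := Cc_support Cf.
have [ac|ac] := ltP a c.
  have near0 : \forall z \near a, ext0 f z = 0.
    have : \forall z \near a, z < c by exact: lt_nbhsl.
    apply: filterS => z zc; have [z0|z0] := leP z 0; first exact: ext0_le0.
    rewrite -[z]/(\val (mkRpos z0)) ext0_val; apply/eqP.
    by apply: contraTT zc => /fcb /andP[/ltW]; rewrite -leNgt.
  rewrite /continuous_at (nbhs_singleton near0).
  by apply: cvg_near_cst; apply: filterS near0 => z ->.
have a0 : 0 < a by exact: lt_le_trans ac.
rewrite /continuous_at -[in X in _ --> X](_ : \val (mkRpos a0) = a)// ext0_val.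
move=> V /(Cf.1 (mkRpos a0)); rewrite nbhsE => -[U [/open_Rpos[W oW WU] Ua] UV].
have : \forall z \near a, W z /\ 0 < z.
  apply: filterI; last exact: lt_nbhsr.
  by apply: open_nbhs_nbhs; split=> //; move: Ua; rewrite -WU.
apply: filterS => z [Wz z0] /=; rewrite -[z]/(\val (mkRpos z0)) ext0_val.
by apply: UV; rewrite -WU.
Qed.

End vague_topology.

(** * Purely atomic measures *)
Section finitely_many_atoms.
Context d (S : measurableType d) (R : realType).
Variables (m : {measure set S -> \bar R}) (U : set S).
Variables (N : nat) (w : pred nat) (p : nat -> S).
Hypothesis mU : measurable U.
Hypothesis wU : forall n, w n -> U (p n).
Hypothesis mE : forall A, measurable A -> A `<=` U ->
  (m A = \sum_(n < N | w n) \d_(p n) A)%E.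

Let atom (n : nat) : {measure set S -> \bar R} :=
  if w n then (\d_(p n) : {measure set S -> \bar R})
  else (mzero : {measure set S -> \bar R}).

Let ge0_integral_atoms (h : S -> \bar R) : measurable_fun U h ->
  (forall x, 0 <= h x)%E ->
  (\int[m]_(x in U) h x = \sum_(n < N | w n) h (p n))%E.
Proof.
move=> mh h0; rewrite (eq_measure_integral (msum atom N)); last first.
  move=> A mA AU; rewrite mE// /msum big_mkcond/=; apply: eq_bigr => n _.
  by rewrite /atom; case: ifP.
rewrite ge0_integral_measure_sum// [RHS]big_mkcond/=; apply: eq_bigr => n _.
rewrite /atom; case: ifPn => wn; last by rewrite integral_measure_zero.
by rewrite integral_dirac// diracE mem_set ?mul1e//; exact: wU.
Qed.

(** The formula for [m] is only required inside [U]: a locally finite sum of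
    Dirac masses has finitely many terms on a bounded set, not globally. *)
Lemma Rintegral_atoms (f : S -> R) : measurable_fun U f ->
  (\int[m]_(x in U) f x)%R = \sum_(n < N | w n) f (p n).
Proof.
move=> /measurable_EFinP mf; rewrite /Rintegral integralE.
rewrite !ge0_integral_atoms//; last 2 first.
  - exact: measurable_funeneg.
  - exact: measurable_funepos.
rewrite funerpos funerneg/= !sumEFin -EFinB/= -sumrB; apply: eq_bigr => n _.
by rewrite -[in RHS](funrposBneg f).
Qed.

End finitely_many_atoms.

Section counting.
Context d (S : measurableType d) (R : realType).
Variable H : set S.

Lemma dirac_sum_count (B : set S) :
  dirac_sum R H B = (\esum_(t in H `&` B) 1)%E.
Proof.
by rewrite esum_mkcondr; apply: eq_esum => t _; rewrite diracE; case: (t \in _).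
Qed.

Lemma dirac_sum_integer (B : set S) :
  dirac_sum R H B = +oo%E \/ exists k : int, dirac_sum R H B = (k%:~R)%:E.
Proof.
rewrite dirac_sum_count.
have [fin|inf] := pselect (finite_set (H `&` B)).
  by right; rewrite finite_card_sum//; exists (Posz #|` fset_set (H `&` B)|).
left; rewrite -(infinite_card_dirac R inf); apply: eq_esum => t HBt.
by rewrite diracE mem_set.
Qed.

Lemma dirac_sum_set1 t : (dirac_sum R H [set t] <= 1)%E.
Proof.
rewrite dirac_sum_count esum_mkcondl esum_set1; last by case: ifP.
by case: ifP; rewrite lee_fin.
Qed.

End counting.

(** * Visits of an orbit to the base *)
Section visits.
Context d (Y : measurableType d) (R : realType) (T : Y -> Y) (r : Y -> R).
Hypothesis r_gt0 : 0 < inf (range r).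
Local Notation X := (susp r_gt0).
Local Notation S := (birkhoff T r).
Implicit Types (x : X) (y : Y) (D : set Y).

Lemma susp_ge0 x : 0 <= (\val x).2.
Proof. by have /andP[] := valP x. Qed.

Lemma susp_lt x : (\val x).2 < r (\val x).1.
Proof. by have /andP[] := valP x. Qed.

Lemma birkhoff0 y : S 0 y = 0.
Proof. by rewrite /birkhoff big_ord0. Qed.

Lemma birkhoffD m n y : S (m + n) y = S m y + S n (iter m T y).
Proof.
elim: n => [|n IH]; first by rewrite addn0 birkhoff0 addr0.
by rewrite addnS !birkhoffS IH -iterD addnC addrA.
Qed.

Lemma birkhoffSl n y : S n.+1 y = r y + S n (T y).
Proof. by rewrite -add1n birkhoffD birkhoffS birkhoff0 add0r. Qed.

Lemma lt_birkhoff m n y : (m < n)%N -> S m y < S n y.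
Proof.
move=> /(le_birkhoff T r_gt0 y); apply: lt_le_trans.
by rewrite birkhoffS ltrDl (lt_le_trans r_gt0)// roof_ge.
Qed.

Lemma birkhoff_inj y : injective (S ^~ y).
Proof.
move=> m n e; have [mn|nm|//] := ltngtP m n.
- by have := lt_birkhoff y mn; rewrite e ltxx.
- by have := lt_birkhoff y nm; rewrite e ltxx.
Qed.

(** For [n = 0] this is the nonpositive time at which the fibre was entered. *)
Definition visit (n : nat) (x : X) : R := S n (\val x).1 - (\val x).2.

Lemma visit_inj x : injective (visit ^~ x).
Proof. by move=> m n /addIr /birkhoff_inj. Qed.

Lemma le_visit m n x : (m <= n)%N -> visit m x <= visit n x.
Proof. by move=> mn; rewrite lerD2r le_birkhoff. Qed.

Lemma visit_unbounded x b : exists N, b < visit N x.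
Proof.
pose s := (\val x).2.
exists (Num.truncn ((s + b) / inf (range r))).+1.
rewrite ltrBrDl; apply: lt_le_trans (birkhoff_ge T r_gt0 _ _).
by rewrite -ltr_pdivrMr// truncnS_gt.
Qed.

Lemma hitsP D x t :
  hits T D x t <-> exists2 n, D (iter n T (\val x).1) & \val t = visit n x.
Proof.
have t0 := ltW (Rpos_gt0 t).
split=> [|[n Dn tn]].
  have [n nst] := flow_index_exists T r_gt0 (\val x).1
    (addr_ge0 (susp_ge0 x) t0).
  rewrite /hits/= (semiflowE t0 nst) => -[/= Dn /eqP].
  by rewrite subr_eq0 => /eqP st; exists n => //; rewrite /visit -st addrAC subrr add0r.
have st : (\val x).2 + \val t = S n (\val x).1 by rewrite tn addrC subrK.
rewrite /hits/= (semiflowE (n := n) t0) st ?subrr//.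
by rewrite lexx lt_birkhoff.
Qed.

(** If the flow passes [m] visits during time [u], then by the cocycle identity
    [birkhoffD] the visits of the flowed point are those of [x] of index at
    least [m], each reached earlier by [u]. *)
Lemma hits_semiflow D (u : {nonneg R}) x :
  hits T D (semiflow T u%:num x) = [set t | hits T D x (Rpos_add t u)].
Proof.
have u0 : 0 <= u%:num by [].
have [m msu] := flow_index_exists T r_gt0 (\val x).1 (addr_ge0 (susp_ge0 x) u0).
have visitE n : visit n (semiflow T u%:num x) = visit (m + n) x - u%:num.
  rewrite /visit (semiflowE u0 msu)/= birkhoffD; lra.
have iterE n : iter n T (\val (semiflow T u%:num x)).1 =
    iter (m + n) T (\val x).1.
  by rewrite (semiflowE u0 msu)/= -iterD addnC.
apply/seteqP; split => t /=.
  move=> /hitsP[n Dn tn]; apply/hitsP; exists (m + n)%N; first by rewrite -iterE.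
  by rewrite /= tn visitE subrK.
move=> /hitsP[k Dk tk0]; apply/hitsP.
have tk : \val t + u%:num = visit k x by [].
(* as t > 0, the k-th visit comes after time u, hence after the m-th one *)
have mk : (m <= k)%N.
  rewrite leqNgt; apply/negP => /ltnW /(le_birkhoff T r_gt0 (\val x).1).
  have t0 := Rpos_gt0 t; move: msu tk => /andP[+ _]; rewrite /visit; lra.
exists (k - m)%N; first by rewrite iterE subnKC.
by rewrite visitE subnKC// -tk addrK.
Qed.

Lemma dirac_sum_hits D x (A : set (borel (Rpos R))) N :
  (forall t : Rpos R, A t -> \val t < visit N x) ->
  dirac_sum R (hits T D x : set (borel (Rpos R))) A =
  (\sum_(n < N | (iter n T (\val x).1 \in D) &&
      (visit n x \in [set \val t | t in (A : set (Rpos R))])) 1)%E.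
Proof.
move=> AN.
pose I := [set n | iter n T (\val x).1 \in D /\
      visit n x \in [set \val t | t in (A : set (Rpos R))]].
rewrite dirac_sum_count.
rewrite -(esum_image _ (\val : Rpos R -> R) (cst 1%E))//; last first.
  by move=> ? ? _ _ /val_inj.
have -> : [set \val t | t in hits T D x `&` (A : set (Rpos R))] =
    (visit ^~ x) @` (`I_N `&` I).
  apply/seteqP; split => [_ [t [/hitsP[n Dn tn] At] <-]|].
    exists n => //; split.
      rewrite /= ltnNge; apply/negP => /(@le_visit _ _ x).
      by rewrite -tn leNgt AN.
    by split; apply/mem_set => //; exists t.
  move=> _ [n [_ [/set_mem Dn /set_mem[t At tn]]] <-].
  by exists t => //; split => //; apply/hitsP; exists n.
rewrite esum_image; last by move=> ? ? _ _ /visit_inj.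
rewrite esum_mkcondr esum_fset//; last by move=> ? _; case: ifP.
rewrite -fsbig_ord [RHS]big_mkcond/=; apply: eq_bigr => n _.
set b := (X in if X then _ else _); set b' := (X in _ = if X then _ else _).
by rewrite (_ : b = b')//; apply/idP/andP => [/set_mem|H]; last exact/mem_set.
Qed.

(** Extending [f] by zero lets the sum run over all visits below [N], those at
    nonpositive times included, so that the range of summation does not depend
    on [x]. *)
Lemma Rintegral_hits D x (f : Rpos R -> R) N :
  continuous f -> (forall t, f t != 0 -> \val t < visit N x) ->
  (\int[hitting_measure T D x]_t f t)%R =
  \sum_(n < N) \1_D (iter n T (\val x).1) * ext0 f (visit n x).
Proof.
move=> fc fN.
pose U : set (borel (Rpos R)) := [set t : Rpos R | \val t < visit N x].
have mU : measurable U.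
  apply: sub_sigma_algebra; apply/open_Rpos; exists [set a | a < visit N x] => //.
have -> : (\int[hitting_measure T D x]_t f t)%R =
    (\int[hitting_measure T D x]_(t in U) f t)%R.
  rewrite [RHS]Rintegral_mkcond; congr Rintegral; apply/funext => t.
  rewrite /patch; case: ifPn => // tU.
  by apply: contraNeq tU => /fN tN; exact/mem_set.
pose w n := (iter n T (\val x).1 \in D) && (0 < visit n x < visit N x).
rewrite (@Rintegral_atoms _ _ _ _ U N w (fun n => to_Rpos (visit n x)))//; last 3 first.
- by move=> n /and3P[_ n0 nN]; rewrite /U/= to_RposK.
- move=> A mA AU; rewrite [LHS](dirac_sum_hits _ AU).
  rewrite [LHS]big_mkcond [RHS]big_mkcond; apply: eq_bigr => n _ /=.
  rewrite /w; case: (_ \in D) => //=; rewrite diracE.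
  case: (boolP (0 < _ < _)) => [/andP[n0 nN]|n0N].
    rewrite (_ : (_ \in [set _ | _ in _]) = (to_Rpos (visit n x) \in A)).
      by case: ifP.
    apply/idP/idP => /set_mem; last first.
      by move=> An; apply/mem_set; exists (to_Rpos (visit n x)); rewrite ?to_RposK.
    move=> [t At tn]; apply/mem_set; rewrite -tn (_ : to_Rpos _ = t)//.
    by apply/val_inj; rewrite to_RposK// Rpos_gt0.
  rewrite ifF//; apply: contraNF n0N => /set_mem[t At <-].
  by rewrite Rpos_gt0/=; exact: AU.
- apply: measurable_funTS; exact: continuous_measurable_Rpos.
rewrite big_mkcond/=; apply: eq_bigr => n _; rewrite indicE /w /ext0.
case: (_ \in D) => /=; rewrite ?mul0r// mul1r.
case: ltP => //= n0; case: ltP => // nN.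
apply/esym/eqP; apply: contraLR nN => /fN.
by rewrite to_RposK// -ltNge.
Qed.

End visits.

(** * Measurability of the hitting process *)
Section measurability.
Context d (Y : measurableType d) (R : realType) (T : Y -> Y) (r : Y -> R).
Hypothesis r_gt0 : 0 < inf (range r).
Local Notation X := (susp r_gt0).
Local Notation S := (birkhoff T r).
Hypotheses (mT : measurable_fun setT T) (mr : measurable_fun setT r).

Lemma measurable_suspP (B : set X) :
  measurable B <-> exists2 C : set (Y * R), measurable C & \val @^-1` C = B.
Proof. by split=> -[C mC <-]; exists C => //; rewrite setTI. Qed.

Lemma measurable_val_susp :
  measurable_fun setT (\val : X -> Y * R).
Proof.
by move=> _ C mC; rewrite setTI; apply/measurable_suspP; exists C.
Qed.

Lemma measurable_iter n : measurable_fun setT (iter n T).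
Proof. by elim: n => [|n IH]; [exact: measurable_id|exact: measurableT_comp]. Qed.

Lemma measurable_birkhoff n : measurable_fun setT (S n).
Proof.
apply: measurable_sum => j.
exact: (measurableT_comp mr (measurable_iter j)).
Qed.

Lemma measurable_visit n : measurable_fun setT (visit T n : X -> R).
Proof.
apply: measurable_funB; last exact: measurableT_comp measurable_val_susp.
apply: (measurableT_comp (measurable_birkhoff n)).
exact: measurableT_comp measurable_val_susp.
Qed.

Variable D : set Y.
Hypothesis mD : measurable D.

Lemma measurable_mark n :
  measurable_fun setT (fun x : X => \1_D (iter n T (\val x).1) : R).
Proof.
apply: (measurableT_comp (measurable_indic mD)).
apply: (measurableT_comp (measurable_iter n)).
exact: measurableT_comp measurable_val_susp.
Qed.

Definition visit_or_mark (i : nat + nat) (x : X) : R :=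
  match i with
  | inl n => visit T n x
  | inr n => \1_D (iter n T (\val x).1)
  end.

(** If a test function is supported below [b], then [N] visits are enough to
    compute its integral as soon as the [N]-th one comes after [b], which is an
    open condition on the coordinates. *)
Lemma cvg_hitting_measure x :
  hitting_measure T D y @[y --> box_filter visit_or_mark x] -->
    hitting_measure T D x.
Proof.
apply: vague_cvg => f Cf; have [a [b [_ fab]]] := Cc_support Cf.
have [N bN] := visit_unbounded T x b.
have nearN : \forall y \near box_filter visit_or_mark x, b < visit T N y.
  exact: (@cvg_box_filter _ _ _ _ visit_or_mark (inl N) x) _ (lt_nbhsr bN).
rewrite (Rintegral_hits (N := N) D Cf.1); last first.
  by move=> t /fab /andP[_ /lt_trans]; apply.
apply: (cvg_trans (G := (\sum_(n < N) \1_D (iter n T (\val y).1) *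
    ext0 f (visit T n y)) @[y --> box_filter visit_or_mark x])).
  apply: near_eq_cvg; apply: filterS nearN => y bNy.
  rewrite (Rintegral_hits (N := N) D Cf.1)// => t /fab /andP[_ /lt_trans].
  exact.
apply: cvg_big => [|n _]; first exact: add_continuous.
apply: cvgM; first exact: (@cvg_box_filter _ _ _ _ visit_or_mark (inr (n : nat)) x).
apply: continuous_cvg; first exact: continuous_ext0.
exact: (@cvg_box_filter _ _ _ _ visit_or_mark (inl (n : nat)) x).
Qed.

Lemma random_hitting_measure :
  random_measure (hitting_measure T D : X -> lfmeasure R).
Proof.
rewrite /random_measure.
apply: (@measurability _ _ _ (borel (lfmeasure R)) _ _ (@open (lfmeasure R))).
  by [].
move=> _ [U oU <-].
rewrite setTI; apply: (measurable_box_open (g := visit_or_mark)).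
  by case=> n; [exact: measurable_visit|exact: measurable_mark].
move=> x Ux; apply: cvg_hitting_measure.
exact: open_nbhs_nbhs.
Qed.

End measurability.

(** * Shifts of the hitting process *)
Lemma lfmeasure_ext (R : realType) (m1 m2 : lfmeasure R) :
  (forall B, m1 B = m2 B) -> m1 = m2.
Proof.
case: m1 m2 => [m1 lf1] [m2 lf2] /= m12.
have e : m1 = m2 by apply: eq_measure; exact/funext.
by rewrite e in lf1 *; congr LFMeasure; exact: Prop_irrelevance.
Qed.

Section shift_hits.
Context d (Y : measurableType d) (R : realType) (T : Y -> Y) (r : Y -> R).
Hypothesis r_gt0 : 0 < inf (range r).

Lemma shift_hitting_measure (D : set Y) (u : {nonneg R}) (x : susp r_gt0) :
  Defs.shift u (hitting_measure T D x) = hitting_measure T D (semiflow T u%:num x).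
Proof.
apply: lfmeasure_ext => B.
rewrite /= /shift_measure/= !dirac_sum_count hits_semiflow.
rewrite -[RHS](esum_image _ (fun t : Rpos R => Rpos_add t u) (cst 1%E))//; last first.
  by move=> s t _ _ /(congr1 val)/= /addIr e; exact: val_inj.
congr esum; apply/seteqP; split => t.
  by rewrite translateE => -[Ht [s Bs st]]; exists s => //; split => //=; rewrite st.
by rewrite translateE => -[s [Hs Bs] <-]; split => //; exists s.
Qed.

End shift_hits.

(** * Invariance of the suspension measure *)
Section lebesgue_translation.
Context (R : realType).
Local Notation lambda := (@lebesgue_measure R).

Lemma measurable_shiftr (a : R) : measurable_fun setT (fun s : R => s + a).
Proof. by apply: measurable_funD. Qed.

Lemma lebesgue_measure_shift (a : R) (E : set R) : measurable E ->
  lambda [set s | E (s + a)] = lambda E.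
Proof.
move=> mE.
have ma : measurable_fun setT ((fun s => s + a) : _ -> measurableTypeR R).
  exact: measurable_shiftr.
rewrite -[LHS]/(pushforward lambda ((fun s => s + a) : _ -> measurableTypeR R) E).
apply/esym/lebesgue_measure_unique => //= _ [[x y] _ <-].
rewrite /pushforward/=.
rewrite (_ : _ @^-1` _ = `]x - a, y - a]%classic); last first.
  by apply/seteqP; split => s /=; rewrite !in_itv/= ltrBlDr lerBrDr.
rewrite !lebesgue_measure_itv/= !lte_fin ltrD2r.
by case: ifP => // _; rewrite -!EFinB; congr EFin; lra.
Qed.

Lemma lebesgue_measure_concat (E : set R) (a b : R) : measurable E ->
  0 <= a -> 0 <= b ->
  (lambda (E `&` `[0%R, a[) + lambda [set s | (0 <= s < b)%R /\ E (s + a)%R])%E =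
  lambda (E `&` `[0%R, a + b[).
Proof.
move=> mE a0 b0.
have -> : [set s | 0 <= s < b /\ E (s + a)] =
    [set s | (E `&` `[a, a + b[) (s + a)].
  apply/seteqP; split => s /=; rewrite in_itv/=.
    by move=> [/andP[s0 sb] Es]; split => //; apply/andP; split; lra.
  by move=> [Es /andP[sa sb]]; split => //; apply/andP; split; lra.
rewrite lebesgue_measure_shift; last exact: measurableI.
rewrite -measureU; [|exact: measurableI|exact: measurableI|]; last first.
  apply/seteqP; split => // s [[_ +] [_ +]]; rewrite /= !in_itv/=.
  by move=> /andP[_ sa]; rewrite leNgt sa.
rewrite -setIUr; congr (lambda (E `&` _)); apply/seteqP; split => s /=.
  by rewrite !in_itv/= => -[|]/andP[? ?]; apply/andP; split; lra.
rewrite !in_itv/= => /andP[s0 sb]; have [sa|sa] := ltP s a; [left|right].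
- by rewrite s0.
- by rewrite sb.
Qed.

End lebesgue_translation.

Lemma measurable_bool_set d (X : measurableType d) (b : X -> bool) :
  measurable_fun setT b -> measurable [set x | b x].
Proof.
move=> mb; rewrite (_ : [set x | _] = setT `&` b @^-1` [set true]); first exact: mb.
by rewrite setTI.
Qed.

Lemma integral_preserved d (Y : measurableType d) (R : realType)
    (mu : {measure set Y -> \bar R}) (T : Y -> Y) (f : Y -> \bar R) :
  measurable_fun setT T ->
  (forall A : set Y, measurable A -> mu (T @^-1` A) = mu A) ->
  measurable_fun setT f -> (forall y, 0 <= f y)%E ->
  (\int[mu]_y f (T y) = \int[mu]_y f y)%E.
Proof.
move=> mT muT mf f0.
have := ge0_integral_pushforward mT mu measurableT mf (fun y _ => f0 y).
rewrite preimage_setT => <-; apply: eq_measure_integral => A mA _.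
exact: muT.
Qed.

Section semiflow_invariance.
Context d (Y : measurableType d) (R : realType) (T : Y -> Y) (r : Y -> R).
Hypothesis r_gt0 : 0 < inf (range r).
Local Notation X := (susp r_gt0).
Local Notation S := (birkhoff T r).
Local Notation lambda := (@lebesgue_measure R).
Hypotheses (mT : measurable_fun setT T) (mr : measurable_fun setT r).
Implicit Types (C : set (Y * R)) (y : Y).

Definition under_roof : set (Y * R) := [set p | 0 <= p.2 < r p.1].

Lemma roof_ge0 y : 0 <= r y.
Proof. by rewrite (le_trans (ltW r_gt0))// roof_ge. Qed.

Lemma measurable_under_roof : measurable under_roof.
Proof.
apply: measurable_bool_set; apply: measurable_and.
  exact: measurable_fun_ler.
by apply: measurable_fun_ltr => //; exact: measurableT_comp.
Qed.

(** The pairs (y, a) with [0 <= a] such that, climbing for time [a] from the base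
    point (y, 0) along the semi-flow, one arrives in [C]. *)
Definition unfolding C : set (Y * R) :=
  \bigcup_n [set p | S n p.1 <= p.2 < S n.+1 p.1 /\
                     C (iter n T p.1, p.2 - S n p.1)].

Lemma measurable_unfolding C : measurable C -> measurable (unfolding C).
Proof.
move=> mC; apply: bigcupT_measurable => n.
have mS k : measurable_fun setT (fun p : Y * R => S k p.1).
  by apply: measurableT_comp (measurable_birkhoff mT mr k) _.
apply: measurableI.
  apply: measurable_bool_set; apply: measurable_and.
    exact: measurable_fun_ler.
  exact: measurable_fun_ltr.
suff : measurable_fun setT (fun p : Y * R => (iter n T p.1, p.2 - S n p.1)).
  by move=> /(_ measurableT _ mC); rewrite setTI.
apply: measurable_fun_pair.
  exact: measurableT_comp (measurable_iter mT n) _.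
exact: measurable_funB.
Qed.

Lemma unfolding_under_roof C y s : 0 <= s < r y -> unfolding C (y, s) <-> C (y, s).
Proof.
move=> sr; have S0 : S 0 y <= s < S 1 y.
  by rewrite birkhoffSl birkhoff0 birkhoff0 addr0.
split=> [[n _ [/= Sn]]|Cys].
  by have -> := flow_index_unique r_gt0 Sn S0; rewrite birkhoff0 subr0.
by exists 0%N => //; split=> //=; rewrite birkhoff0 subr0.
Qed.

(** Climbing to the roof over [y] is the same as starting afresh at [T y]. *)
Lemma unfolding_roof C y s : 0 <= s ->
  unfolding C (y, s + r y) <-> unfolding C (T y, s).
Proof.
have subE n : s + r y - S n.+1 y = s - S n (T y) by rewrite birkhoffSl; lra.
move=> s0; split=> [[n _ [/= Sn Cn]]|[n _ [/= Sn Cn]]].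
  case: n Sn Cn => [|n] Sn.
    by move: Sn => /andP[_]; rewrite birkhoffSl birkhoff0; lra.
  rewrite subE iterSr => Cn; exists n => //; split => //=.
  by move: Sn; rewrite 2!birkhoffSl [s + _]addrC lerD2l ltrD2l.
exists n.+1 => //; split; last by rewrite /= subE -iterS iterSr.
by rewrite /= 2!birkhoffSl [s + _]addrC lerD2l ltrD2l.
Qed.

Lemma semiflow_unfolding C u (x : X) : 0 <= u ->
  C (\val (semiflow T u x)) <-> unfolding C ((\val x).1, (\val x).2 + u).
Proof.
move=> u0.
have [n nsu] := flow_index_exists T r_gt0 (\val x).1 (addr_ge0 (susp_ge0 x) u0).
rewrite (semiflowE u0 nsu); split=> [Cn|[m _ [/= Sm]]]; first by exists n.
by rewrite (flow_index_unique r_gt0 Sm nsu).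
Qed.

Variables (mu : probability Y R) (nu : probability X R).
Hypothesis nuE : susp_measure mu nu.
Hypothesis muT : forall A : set Y, measurable A -> mu (T @^-1` A) = mu A.

(** Intersecting with [under_roof] expresses the integral over the fibre as the
    length of a section of a measurable subset of [Y * R], so that measurability
    in [y] comes from the product structure. *)
Lemma susp_measure_preimage C : measurable C ->
  nu (\val @^-1` C) = (((\int[mu]_y r y)%R^-1)%:E *
    \int[mu]_y lambda (xsection (C `&` under_roof) y))%E.
Proof.
move=> mC.
have mB : measurable (\val @^-1` C : set X) by apply/measurable_suspP; exists C.
have := nuE (measurable_indic mB) (fun x => ler0n _ _).
rewrite integral_indic// setIT => ->; congr (_ * _)%E.
apply: eq_integral => y _.
transitivity (\int[lambda]_(s in `[0%R, r y[) (\1_(xsection C y) s)%:E)%E.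
  apply: eq_integral => s /set_mem; rewrite /= in_itv/= => sr; congr EFin.
  by rewrite /susp_ext insubT/= !indicE mem_xsection.
rewrite integral_indic//; last exact: measurable_xsection.
congr lambda; apply/seteqP; split => s.
  by move=> [/xsectionP Cs sr]; apply/xsectionP; split => //; move: sr; rewrite /= in_itv.
by move=> /xsectionP [Cs sr]; split; [exact/xsectionP|rewrite /= in_itv].
Qed.

(** Cut the section of the unfolding over [0, u + r y[ at [u] and at [r y]: the
    pieces of length [u] have the same integral because [T] preserves [mu], and
    the others compute the two sides. *)
Lemma semiflow_invariant (u : R) (B : set X) : 0 <= u -> measurable B ->
  nu (semiflow T u @^-1` B) = nu B.
Proof.
move=> u0 /measurable_suspP[C mC <-].
pose G := unfolding C; have mG : measurable G := measurable_unfolding mC.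
pose Gu : set (Y * R) := G `&` [set p | 0 <= p.2 < u].
pose C' : set (Y * R) := [set p | G (p.1, p.2 + u)].
have mu_itv : measurable [set p : Y * R | 0 <= p.2 < u].
  apply: measurable_bool_set; apply: measurable_and.
    exact: measurable_fun_ler.
  exact: measurable_fun_ltr.
have mGu : measurable Gu by exact: measurableI.
have mC' : measurable C'.
  rewrite -[C']setTI.
  suff : measurable_fun setT (fun p : Y * R => (p.1, p.2 + u)) by exact.
  by apply/measurable_fun_pair => //; exact: measurable_funD.
have -> : semiflow T u @^-1` (\val @^-1` C) = \val @^-1` C' :> set X.
  apply/seteqP; split => x /=.
    by move/semiflow_unfolding; apply.
  by move=> ?; apply/semiflow_unfolding.
rewrite !susp_measure_preimage//; congr (_ * _)%E.
have mlam A : measurable A -> measurable_fun setT (fun y => lambda (xsection A y)).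
  exact: measurable_fun_xsection.
have mroof := measurable_under_roof.
have key y : (lambda (xsection Gu y) + lambda (xsection (C' `&` under_roof) y) =
    lambda (xsection (C `&` under_roof) y) + lambda (xsection Gu (T y)))%E.
  have mGy : measurable (xsection G y) by exact: measurable_xsection.
  have ry := roof_ge0 y.
  have := lebesgue_measure_concat mGy u0 ry.
  rewrite [u + _]addrC -(lebesgue_measure_concat mGy ry u0).
  congr (lambda _ + lambda _ = lambda _ + lambda _)%E; apply/seteqP; split => s.
  - by move=> [/xsectionP Gs]; rewrite /= in_itv/= => su; apply/xsectionP.
  - by move=> /xsectionP [Gs su]; split; [exact/xsectionP|rewrite /= in_itv].
  - by move=> /= [sr /xsectionP Gs]; apply/xsectionP.
  - by move=> /xsectionP [Gs sr]; split => //; exact/xsectionP.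
  - move=> [/xsectionP Gs]; rewrite /= in_itv/= => sr; apply/xsectionP; split => //.
    exact/(unfolding_under_roof C sr).
  - move=> /xsectionP [Cs sr]; split; last by rewrite /= in_itv.
    by apply/xsectionP/(unfolding_under_roof C sr).
  - move=> /= [/andP[s0 su] /xsectionP Gs]; apply/xsectionP; split => /=.
      exact/unfolding_roof.
    by rewrite s0.
  - move=> /xsectionP [Gs /= su]; split => //; apply/xsectionP.
    by apply/unfolding_roof => //; case/andP: su.
(* cancelling this integral at the end requires it to be finite *)
have Gu_fin : (\int[mu]_y lambda (xsection Gu y))%E \is a fin_num.
  rewrite ge0_fin_numE; last by apply: integral_ge0 => y _; exact: measure_ge0.
  apply: (@le_lt_trans _ _ (\int[mu]_(_ in [set: Y]) u%:E)%E).
    apply: ge0_le_integral => //.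
    - exact: mlam.
    - move=> y _; apply: (@le_trans _ _ (lambda `[0%R, u[)).
        apply: le_measure => [| |s /xsectionP[_ su]].
        - by apply/mem_set; exact: measurable_xsection.
        - exact/mem_set.
        - by rewrite /= in_itv.
      by rewrite lebesgue_measure_itv/= lte_fin sube0; case: ifP => //; rewrite lee_fin.
  by rewrite integral_cst// -[X in (_ * X)%E]/(mu setT) probability_setT mule1 ltry.
have : (\int[mu]_y (lambda (xsection Gu y) + lambda (xsection (C' `&` under_roof) y)) =
    \int[mu]_y (lambda (xsection (C `&` under_roof) y) + lambda (xsection Gu (T y))))%E.
  by apply: eq_integral => y _; exact: key.
rewrite ge0_integralD//; last 2 first.
- exact: mlam.
- by apply: mlam; exact: measurableI.
rewrite ge0_integralD//; last 2 first.
- by apply: mlam; exact: measurableI.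
- exact: measurableT_comp (mlam _ mGu) mT.
rewrite (integral_preserved (f := fun y => lambda (xsection Gu y)) mT muT)//; last exact: mlam.
rewrite addeC => e.
by rewrite -[LHS](addeK _ Gu_fin) e addeK.
Qed.

End semiflow_invariance.

(** * Intensity *)
Section counting_visits.
Context d (Y : measurableType d) (R : realType) (T : Y -> Y) (r : Y -> R).
Hypothesis r_gt0 : 0 < inf (range r).
Local Notation X := (susp r_gt0).
Local Notation S := (birkhoff T r).
Local Notation lambda := (@lebesgue_measure R).
Hypotheses (mT : measurable_fun setT T) (mr : measurable_fun setT r).
Variables (D : set Y) (mD : measurable D) (L : R) (L0 : 0 < L).

(** On the suspension, the event that the [n]-th visit hits [D] during ]0, L]. *)
Definition visit_window n : set (Y * R) :=
  [set p | D (iter n T p.1) /\ p.2 < S n p.1 <= p.2 + L].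

Definition capped_birkhoff n (y : Y) : R :=
  \1_D (iter n T y) * Num.min (S n y) L.

Lemma measurable_visit_window n : measurable (visit_window n).
Proof.
have mS : measurable_fun setT (fun p : Y * R => S n p.1).
  by apply: measurableT_comp (measurable_birkhoff mT mr n) _.
apply: measurableI.
  have m : measurable_fun setT (fun p : Y * R => iter n T p.1).
    exact: measurableT_comp (measurable_iter mT n) _.
  by have := m measurableT _ mD; rewrite setTI.
apply: measurable_bool_set; apply: measurable_and.
  exact: measurable_fun_ltr.
by apply: measurable_fun_ler => //; exact: measurable_funD.
Qed.

Lemma measurable_capped_birkhoff n : measurable_fun setT (capped_birkhoff n).
Proof.
apply: measurable_funM.
  exact: measurableT_comp (measurable_indic mD) (measurable_iter mT n).
by apply: measurable_minr => //; exact: measurable_birkhoff.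
Qed.

Lemma birkhoff_ge0 n y : 0 <= S n y.
Proof. by rewrite -(birkhoff0 T r y) le_birkhoff. Qed.

Lemma capped_birkhoff_ge0 n y : 0 <= capped_birkhoff n y.
Proof. by rewrite mulr_ge0// le_min birkhoff_ge0 ltW. Qed.

Lemma birkhoff_large b : exists n, forall y, b <= S n y.
Proof.
exists (Num.truncn (b / inf (range r))).+1 => y.
apply: le_trans (birkhoff_ge T r_gt0 _ _).
by rewrite -ler_pdivrMr// ltW// truncnS_gt.
Qed.

(** Below the roof [s < r y], hence visit [n.+1] comes later than [S n (T y)],
    thus after time [L]. *)
Lemma hitting_measure_window n (x : X) : (forall y, L <= S n y) ->
  hitting_measure T D x [set t : Rpos R | \val t <= L] =
  (\sum_(k < n.+1) (\1_(\val @^-1` visit_window k) x)%:E)%E.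
Proof.
move=> LSn; rewrite [LHS](@dirac_sum_hits _ _ _ _ _ _ _ _ _ n.+1)//; last first.
  move=> t tL; apply: le_lt_trans tL _.
  rewrite /visit birkhoffSl; have := susp_lt x; have := LSn (T (\val x).1); lra.
rewrite big_mkcond; apply: eq_bigr => k _ /=; rewrite indicE.
rewrite (_ : (x \in _) = (iter k T (\val x).1 \in D) &&
  (visit T k x \in [set \val t | t in [set t : Rpos R | \val t <= L]])).
  by case: (_ && _).
apply/idP/andP => [/set_mem[Dk /andP[sk kL]]|[/set_mem Dk /set_mem[t tL tk]]].
  split; apply/mem_set => //.
  have v0 : 0 < visit T k x by rewrite subr_gt0.
  by exists (mkRpos v0) => //=; rewrite lerBlDl.
apply/mem_set; split => //=; rewrite -subr_gt0 -lerBlDl.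
by rewrite -[_ - _]/(visit T k x) -tk Rpos_gt0.
Qed.

Lemma lebesgue_visit_window0 y :
  lambda (xsection (visit_window 0 `&` under_roof r) y) = 0%E.
Proof.
rewrite (_ : xsection _ y = set0) ?measure0//; apply/seteqP; split => // s.
move=> /xsectionP [[_ /=]]; rewrite birkhoff0 => /andP[s0 _] /andP[/=].
by rewrite leNgt s0.
Qed.

(** When [T^(n+1) y] is in [D], the fibre is the part of [0, r y[ at distance at
    most [L] below [S n.+1 y = r y + S n (T y)].  Measured downwards from
    [S n.+1 y], it is the part of ]S n (T y), S n.+1 y] in ]0, L], whose length
    is the increment of [min _ L]. *)
Lemma lebesgue_visit_window n y :
  (lambda (xsection (visit_window n.+1 `&` under_roof r) y) +
    (capped_birkhoff n (T y))%:E = (capped_birkhoff n.+1 y)%:E)%E.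
Proof.
rewrite /capped_birkhoff -iterSr indicE.
have [Dn|Dn] := boolP (_ \in D); last first.
  rewrite !mul0r (_ : xsection _ y = set0) ?measure0 ?adde0//.
  apply/seteqP; split => // s /xsectionP [[/mem_set Dy _] _].
  by rewrite Dy in Dn.
have ry := roof_ge0 r_gt0 y; have Sn := birkhoff_ge0 n (T y).
have -> : xsection (visit_window n.+1 `&` under_roof r) y =
    `[Num.max 0 (S n.+1 y - L), r y[%classic.
  apply/seteqP; split => s /=; rewrite in_itv/= ge_max.
    move=> /xsectionP [[_ /= /andP[_ sL]] /= /andP[s0 sr]].
    by rewrite s0 sr lerBlDr sL.
  move=> /andP[/andP[s0 sL] sr]; apply/xsectionP; split; last first.
    by rewrite /under_roof/= s0.
  split; first exact/set_mem.
  rewrite /= -lerBlDr sL andbT birkhoffSl; lra.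
rewrite lebesgue_measure_itv/= lte_fin !mul1r birkhoffSl.
have EFin_eq (a b : R) : a = b -> a%:E = b%:E by move=> ->.
have [z0|z0] := leP 0 (r y + S n (T y) - L);
  case: ltP => zr; rewrite -?EFinB -EFinD; apply: EFin_eq;
  have [?|?] := leP (S n (T y)) L; have [?|?] := leP (r y + S n (T y)) L; lra.
Qed.

Variable mu : probability Y R.
Hypothesis muT : forall A : set Y, measurable A -> mu (T @^-1` A) = mu A.

Lemma sum_visit_windows n :
  (\sum_(k < n.+1) \int[mu]_y
    lambda (xsection (visit_window k `&` under_roof r) y) =
  \int[mu]_y (capped_birkhoff n y)%:E)%E.
Proof.
have mq k : measurable_fun setT (fun y => (capped_birkhoff k y)%:E).
  by apply/measurable_EFinP; exact: measurable_capped_birkhoff.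
have q0 k y : (0 <= (capped_birkhoff k y)%:E)%E.
  by rewrite lee_fin capped_birkhoff_ge0.
elim: n => [|n IH].
  rewrite big_ord1; apply: eq_integral => y _; rewrite lebesgue_visit_window0.
  by rewrite /capped_birkhoff birkhoff0 min_l ?mulr0// ltW.
rewrite big_ord_recr/= IH addeC.
rewrite -(integral_preserved mT muT (mq n))//.
rewrite -ge0_integralD//; last 2 first.
- apply: measurable_fun_xsection; apply: measurableI.
    exact: measurable_visit_window.
  exact: measurable_under_roof.
- exact: measurableT_comp (mq n) mT.
by apply: eq_integral => y _; exact: lebesgue_visit_window.
Qed.

(** The cap is reached everywhere, and the event [T^n y] in [D] has the
    probability of [D]. *)
Lemma integral_capped_birkhoff n : (forall y, L <= S n y) ->
  (\int[mu]_y (capped_birkhoff n y)%:E = L%:E * mu D)%E.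
Proof.
move=> LSn.
have mi : measurable_fun setT (fun y => (\1_D y)%:E : \bar R).
  by apply/measurable_EFinP; exact: measurable_indic.
transitivity (\int[mu]_y (L%:E * (\1_D (iter n T y))%:E))%E.
  by apply: eq_integral => y _; rewrite /capped_birkhoff min_r// mulrC EFinM.
rewrite ge0_integralZl//; last 2 first.
- exact: measurableT_comp mi (measurable_iter mT n).
- by rewrite lee_fin ltW.
congr (_ * _)%E.
elim: n {LSn} => [|n IH]; first by rewrite integral_indic// setIT.
rewrite -IH; under eq_integral do rewrite iterSr.
apply: (integral_preserved (f := fun y => (\1_D (iter n T y))%:E) mT muT).
  exact: measurableT_comp mi (measurable_iter mT n).
by move=> y; rewrite lee_fin.
Qed.

Variable nu : probability X R.
Hypothesis nuE : susp_measure mu nu.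

Lemma intensity_hitting_measure :
  intensity nu (hitting_measure T D : X -> lfmeasure R) L =
  (((\int[mu]_y r y)^-1)%:E * mu D)%E.
Proof.
have [n LSn] := birkhoff_large L.
have mW k : measurable (\val @^-1` visit_window k : set X).
  by apply/measurable_suspP; exists (visit_window k) => //;
     exact: measurable_visit_window.
rewrite /intensity.
under eq_integral do rewrite (hitting_measure_window _ LSn).
rewrite ge0_integral_sum//; last first.
  by move=> k; apply/measurable_EFinP; exact: measurable_indic.
have nuW k : (\int[nu]_x (\1_(\val @^-1` visit_window k) x)%:E =
    ((\int[mu]_y r y)%R^-1)%:E * \int[mu]_y
      lambda (xsection (visit_window k `&` under_roof r) y))%E.
  rewrite integral_indic// setIT; apply: susp_measure_preimage nuE _ _.
  exact: measurable_visit_window.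
rewrite (eq_bigr _ (fun (k : 'I_n.+1) _ => nuW k)).
rewrite -ge0_sume_distrr; last first.
  by move=> k _; apply: integral_ge0 => y _; exact: measure_ge0.
rewrite sum_visit_windows integral_capped_birkhoff//.
rewrite -muleA; congr (_ * _)%E.
by rewrite muleC muleA -EFinM mulVf ?mul1e// gt_eqF.
Qed.

End counting_visits.

(** * Stationarity and intensity of the hitting process *)
Theorem proposition1 (R : realType) (d : measure_display)
    (Y : measurableType d) (mu : probability Y R)
    (T : Y -> Y) (mT : measurable_fun setT T)
    (muT : forall A : set Y, measurable A -> mu (T @^-1` A) = mu A)
    (r : Y -> R) (r_L1 : mu.-integrable setT (EFin \o r))
    (r_gt0 : 0 < inf (range r))
    (D : set Y) (mD : measurable D)
    (nu : probability (susp r_gt0) R) (nuE : susp_measure mu nu) :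
  let xi : susp r_gt0 -> lfmeasure R := hitting_measure T D in
  [/\ point_process xi,
      simple nu xi,
      stationary nu xi &
      forall L : R, 0 < L ->
        intensity nu xi L = (((\int[mu]_y r y)^-1)%:E * mu D)%E].
Proof.
have mr : measurable_fun setT r by apply/measurable_EFinP; exact: measurable_int r_L1.
move=> xi; have mxi : random_measure xi by exact: random_hitting_measure.
split.
- by split => // x B _; exact: dirac_sum_integer.
- apply: aeW => x; apply: ge_ereal_sup => _ [t _ <-]; exact: dirac_sum_set1.
- move=> u A mA.
  have mB : measurable (xi @^-1` A) by rewrite -[_ @^-1` _]setTI; exact: mxi.
  rewrite /pushforward -[RHS](semiflow_invariant mT mr nuE muT (ge0 u) mB).
  congr (nu _); apply/seteqP; split => x /=; rewrite shift_hitting_measure//.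
- by move=> L L0; exact: intensity_hitting_measure.
Qed.
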